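(* Let $n\ge 1$. The set $\mathscr{C}_n$ of all $(k_1,\dots,k_n)\in\mathbb{R}^n$ for which there exists an $n\times n$ real matrix with all entries nonnegative whose characteristic polynomial is $x^n+k_1x^{n-1}+\dots+k_{n-1}x+k_n$ is a semi-algebraic subset of $\mathbb{R}^n$.
   Context: The characteristic polynomial of an $n\times n$ matrix $A$ is the monic polynomial $\det(xI-A)$. The elements of $\mathscr{C}_n$ are called realizable coefficients. A semi-algebraic subset of $\mathbb{R}^n$ is a set of the form $\bigcup_{i=1}^s\bigcap_{j=1}^{r_i}\{x\in\mathbb{R}^n : f_{i,j}(x) *_{i,j} 0\}$, where $f_{i,j}\in\mathbb{R}[X_1,\dots,X_n]$ and each $*_{i,j}$ is one of $>$, $\ge$, $=$. *)

(* Defs.v *)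
From HB Require Import structures.
From mathcomp Require Import all_boot all_order all_algebra.
From mathcomp Require Import classical_sets reals mpoly.

Set Implicit Arguments.
Unset Strict Implicit.
Unset Printing Implicit Defensive.

Import Order.TTheory GRing.Theory Num.Theory.

Local Open Scope ring_scope.
Local Open Scope classical_set_scope.

Variant sign_condition := Positive | Nonnegative | Null.

Definition satisfies (R : realType) (c : sign_condition) (a : R) : Prop :=
  match c with
  | Positive => a > 0
  | Nonnegative => a >= 0
  | Null => a = 0
  end.

(* Empty unions (s = 0) and empty intersections (r i = 0) are allowed; they add
   no new sets, since set0 = {-1 > 0} and setT = {0 = 0}. *)
Definition semialgebraic (R : realType) (n : nat) (S : set 'rV[R]_n) : Prop :=
  exists (s : nat) (r : 'I_s -> nat)
         (f : forall i : 'I_s, 'I_(r i) -> {mpoly R[n]})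
         (c : forall i : 'I_s, 'I_(r i) -> sign_condition),
    S = \bigcup_(i in [set: 'I_s]) \bigcap_(j in [set: 'I_(r i)])
          [set x : 'rV[R]_n | satisfies (c i j) (f i j).@[fun l => x ord0 l]].

(* The coordinate k ord0 i, with i counted from 0, is the k_{i+1} of the usual
   numbering, hence the coefficient of 'X^(n - (i + 1)). *)
Definition realizable_coefficients (R : realType) (n : nat) : set 'rV[R]_n :=
  [set k : 'rV[R]_n | exists A : 'M[R]_n,
     (forall i j, 0 <= A i j) /\
     char_poly A = 'X^n + \sum_(i < n) k ord0 i *: 'X^(n - i.+1)].

(* Main.v *)
Require Import Defs.
From HB Require Import structures.
From mathcomp Require Import all_boot all_order all_algebra.
From mathcomp Require Import classical_sets reals mpoly.
From mathcomp Require ordered_qelim qe_rcf.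

(** The realizable coefficients are the image, under a coordinate projection,
    of a set described by finitely many polynomial conditions: adjoin to
    [k] the [n * n] entries of an unknown matrix [A] as further coordinates, and
    require that each entry be nonnegative and that each coefficient of
    [char_poly A], which is a polynomial in the entries, equal the corresponding
    [k_i]. The conclusion is then the Tarski-Seidenberg theorem
    [semialgebraic_projection]: a projection of a semi-algebraic set is
    semi-algebraic.

    The projection theorem is read off from quantifier elimination for real
    closed fields. A semi-algebraic set is defined by a first-order formula in
    the language of ordered rings with parameters in [R]
    ([formula_of_semialgebraic]), projecting it prefixes the formula with
    existential quantifiers ([holds_exists_iota]), and elimination replaces the
    outcome by an equivalent quantifier-free formula. Conversely a
    quantifier-free formula defines a semi-algebraic set ([semialgebraic_qf]),
    because semi-algebraic sets form a Boolean algebra containing the solution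
    sets of atomic formulas. *)

Set Implicit Arguments.
Unset Strict Implicit.
Unset Printing Implicit Defensive.

Import Order.TTheory GRing.Theory Num.Theory.

Local Open Scope ring_scope.
Local Open Scope classical_set_scope.

Module ord := ordered_qelim.ord.

(** * Boolean algebra of semi-algebraic sets *)

Section DisjunctiveNormalForms.
Variables (R : realType) (n : nat).
Implicit Types (S T : set 'rV[R]_n) (x : 'rV[R]_n) (p : {mpoly R[n]}).

Notation literal := ({mpoly R[n]} * sign_condition)%type.

Definition satisfiesb (c : sign_condition) (a : R) : bool :=
  match c with
  | Positive => 0 < a
  | Nonnegative => 0 <= a
  | Null => a == 0
  end.

Lemma satisfiesP c a : reflect (satisfies c a) (satisfiesb c a).
Proof. by case: c => /=; [exact: idP | exact: idP | exact: eqP]. Qed.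

Definition literal_holds x (l : literal) : bool :=
  satisfiesb l.2 l.1.@[fun i => x ord0 i].

Definition dnf_holds (D : seq (seq literal)) x : bool :=
  has (all (literal_holds x)) D.

(** The dependently typed families in the definition of semi-algebraic sets are
    awkward to concatenate; lists of lists of literals carry the same data, and
    the Boolean operations become list operations. *)
Lemma semialgebraicP S :
  semialgebraic S <-> exists D, forall x, S x <-> dnf_holds D x.
Proof.
split=> [[s [r [f [c ->]]]] | [D SD]].
  exists [seq [seq (f i j, c i j) | j <- enum 'I_(r i)] | i <- enum 'I_s] => x.
  rewrite /dnf_holds has_map; split=> [[i _ ix] | /hasP[i _ /=]].
    apply/hasP; exists i; first exact: mem_enum.
    by rewrite /= all_map; apply/allP => j _; apply/satisfiesP; exact: ix.
  rewrite all_map => /allP ix; exists i => // j _.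
  by apply/satisfiesP; apply: ix; rewrite mem_enum.
pose l (i : 'I_(size D)) (j : 'I_(size (nth [::] D i))) :=
  nth (0 : {mpoly R[n]}, Null) (nth [::] D i) j.
exists (size D), (fun i => size (nth [::] D i)).
exists (fun i j => (l i j).1), (fun i j => (l i j).2).
apply/seteqP; split=> x.
  move=> /SD /(has_nthP [::])[i ltiD /(all_nthP (0, Null)) ix].
  by exists (Ordinal ltiD) => // j _; apply/satisfiesP; exact: ix.
move=> [i _ ix]; apply/SD/(has_nthP [::]); exists i => //.
apply/(all_nthP (0, Null)) => j ltj; apply/satisfiesP.
exact: (ix (Ordinal ltj)).
Qed.

Lemma eq_semialgebraic S T :
  (forall x, S x <-> T x) -> semialgebraic S -> semialgebraic T.
Proof.
move=> eqST /semialgebraicP[D SD]; apply/semialgebraicP; exists D => x.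
by rewrite -eqST.
Qed.

Lemma semialgebraic_literal p c :
  semialgebraic [set x : 'rV[R]_n | satisfies c p.@[fun i => x ord0 i]].
Proof.
apply/semialgebraicP; exists [:: [:: (p, c)]] => x.
by rewrite /dnf_holds /= andbT orbF; split=> /satisfiesP.
Qed.

Lemma semialgebraic0 : semialgebraic (set0 : set 'rV[R]_n).
Proof. by apply/semialgebraicP; exists [::]. Qed.

Lemma semialgebraicT : semialgebraic [set: 'rV[R]_n].
Proof. by apply/semialgebraicP; exists [:: [::]]. Qed.

Lemma semialgebraicU S T :
  semialgebraic S -> semialgebraic T -> semialgebraic (S `|` T).
Proof.
move=> /semialgebraicP[D SD] /semialgebraicP[E TE]; apply/semialgebraicP.
exists (D ++ E) => x; rewrite [dnf_holds _ x]has_cat.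
split=> [[/SD Dx | /TE Ex] | /orP[/SD | /TE]]; [| | by left | by right].
  by apply/orP; left.
by apply/orP; right.
Qed.

(** Intersection distributes over union, so the clauses of the intersection are
    the concatenations of a clause of each set. *)
Lemma semialgebraicI S T :
  semialgebraic S -> semialgebraic T -> semialgebraic (S `&` T).
Proof.
move=> /semialgebraicP[D SD] /semialgebraicP[E TE]; apply/semialgebraicP.
exists [seq d ++ e | d <- D, e <- E] => x.
have -> : dnf_holds [seq d ++ e | d <- D, e <- E] x
          = dnf_holds D x && dnf_holds E x.
  rewrite /dnf_holds; elim: (D) => //= d D' IH.
  rewrite has_cat {}IH has_map andb_orl; congr (_ || _).
  under eq_has => e do rewrite /= all_cat.
  by case: (all _ d); rewrite ?has_pred0.
by split=> [[/SD-> /TE->] // | /andP[/SD ? /TE]].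
Qed.

(** The line is totally ordered, so the negation of a strict or weak inequality
    on [p] is a single inequality on [- p], and that of an equation is the
    disjunction [p > 0] or [- p > 0]; De Morgan's laws do the rest. *)
Lemma semialgebraicC S : semialgebraic S -> semialgebraic (~` S).
Proof.
have litC (l : literal) : semialgebraic [set x | ~~ literal_holds x l].
  case: l => p [].
  - apply: eq_semialgebraic (semialgebraic_literal (- p) Nonnegative) => x /=.
    by rewrite /literal_holds /= mevalN oppr_ge0 leNgt.
  - apply: eq_semialgebraic (semialgebraic_literal (- p) Positive) => x /=.
    by rewrite /literal_holds /= mevalN oppr_gt0 ltNge.
  - apply: eq_semialgebraic (semialgebraicU (semialgebraic_literal p Positive)
      (semialgebraic_literal (- p) Positive)) => x /=.
    rewrite /literal_holds /= mevalN oppr_gt0 neq_lt.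
    by split=> [[-> | ->] | /orP[]]; rewrite ?orbT //; [right | left].
have clauseC (d : seq literal) :
    semialgebraic [set x | ~~ all (literal_holds x) d].
  elim: d => [|l d IH]; first by apply: eq_semialgebraic semialgebraic0.
  apply: eq_semialgebraic (semialgebraicU (litC l) IH) => x /=.
  by rewrite negb_and; split=> [[-> | ->] | /orP[]];
     rewrite ?orbT //; [left | right].
move=> /semialgebraicP[D SD].
suff: semialgebraic [set x | ~~ dnf_holds D x].
  by apply: eq_semialgebraic => x /=; rewrite SD; split=> /negP.
elim: D {SD} => [|d D IH]; first by apply: eq_semialgebraic semialgebraicT.
apply: eq_semialgebraic (semialgebraicI (clauseC d) IH) => x /=.
by rewrite negb_or; split=> [[-> ->] | /andP].
Qed.

Lemma semialgebraic_forall (I : finType) (S : I -> set 'rV[R]_n) :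
  (forall i, semialgebraic (S i)) -> semialgebraic [set x | forall i, S i x].
Proof.
move=> Sa.
have Ssub (s : seq I) : semialgebraic [set x | forall i, i \in s -> S i x].
  elim: s => [|i s IH]; first by apply: eq_semialgebraic semialgebraicT.
  apply: eq_semialgebraic (semialgebraicI (Sa i) IH) => x /=.
  split=> [[Six Ssx] j | Sx].
    by rewrite inE => /orP[/eqP-> | /Ssx].
  by split=> [|j js]; apply: Sx; rewrite inE ?eqxx ?js ?orbT.
apply: eq_semialgebraic (Ssub (enum I)) => x /=.
by split=> Sx i; [apply: Sx; rewrite mem_enum | move=> _].
Qed.

End DisjunctiveNormalForms.

(** * The Tarski-Seidenberg theorem *)

Section Projection.
Variable R : realType.

(** Formulas are evaluated along a list of values, in which variable [i] denotes
    entry [i]; a point is thus encoded by the list of its coordinates. *)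
Definition env n (x : 'rV[R]_n) : seq R := codom (fun i => x ord0 i).

Lemma size_env n (x : 'rV[R]_n) : size (env x) = n.
Proof. by rewrite size_codom card_ord. Qed.

Lemma nth_env n (x : 'rV[R]_n) (i : 'I_n) : (env x)`_i = x ord0 i.
Proof.
rewrite /env /codom /image_mem (nth_map i) ?size_enum_ord //.
by rewrite nth_ord_enum.
Qed.

Lemma envK n (s : seq R) : size s = n ->
  env (\row_(i < n) s`_i) = s.
Proof.
move=> ss; apply: (@eq_from_nth _ 0); first by rewrite size_env.
move=> i; rewrite size_env => lin.
by rewrite (nth_env _ (Ordinal lin)) mxE.
Qed.

Lemma env_row_mx m n (x : 'rV[R]_m) (y : 'rV[R]_n) :
  env (row_mx x y) = env x ++ env y.
Proof.
apply: (@eq_from_nth _ 0); first by rewrite size_cat !size_env.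
move=> i; rewrite size_env => lti.
rewrite (nth_env _ (Ordinal lti)) nth_cat size_env.
case: ltnP => [ltim | leim].
  rewrite (nth_env _ (Ordinal ltim)) -(row_mxEl x y).
  by congr (row_mx _ _ _ _); exact: val_inj.
have ltin : (i - m < n)%N by rewrite ltn_subLR.
rewrite (nth_env _ (Ordinal ltin)) -(row_mxEr x y).
by congr (row_mx _ _ _ _); apply: val_inj; rewrite /= subnKC.
Qed.

(** A variable of index at least [n] has the default value [0] in the
    environment of a point of dimension [n], hence is sent to the polynomial
    [0]. *)
Lemma mpoly_of_term n (t : GRing.term R) : GRing.rterm t ->
  exists p : {mpoly R[n]},
    forall x : 'rV[R]_n, GRing.eval (env x) t = p.@[fun i => x ord0 i].
Proof.
elim: t => //= [i _|a _|k _|t1 IH1 t2 IH2|t IH|t IH k|t1 IH1 t2 IH2|t IH k].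
- have [ltin | lein] := ltnP i n.
    by exists 'X_(Ordinal ltin) => x; rewrite mevalXU -nth_env.
  by exists 0 => x; rewrite meval0 nth_default ?size_env.
- by exists a%:MP => x; rewrite mevalC.
- by exists k%:R => x; rewrite rmorph_nat.
- case/andP=> /IH1[p pE] /IH2[q qE]; exists (p + q) => x.
  by rewrite pE qE mevalD.
- by case/IH=> p pE; exists (- p) => x; rewrite pE mevalN.
- by case/IH=> p pE; exists (p *+ k) => x; rewrite pE mevalMn.
- case/andP=> /IH1[p pE] /IH2[q qE]; exists (p * q) => x.
  by rewrite pE qE mevalM.
- by case/IH=> p pE; exists (p ^+ k) => x; rewrite pE rmorphXn.
Qed.

(** Polynomials are generated by constants and variables under sums and products,
    operations that terms also have. *)
Lemma term_of_mpoly n (p : {mpoly R[n]}) :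
  exists t : GRing.term R, GRing.rterm t /\
    forall x : 'rV[R]_n, GRing.eval (env x) t = p.@[fun i => x ord0 i].
Proof.
pose repr (q : {mpoly R[n]}) := exists t : GRing.term R, GRing.rterm t /\
  forall x : 'rV[R]_n, GRing.eval (env x) t = q.@[fun i => x ord0 i].
have reprC c : repr c%:MP.
  by exists (GRing.Const c); split=> // x; rewrite mevalC.
have reprX i : repr 'X_i.
  by exists (GRing.Var R i); split=> // x; rewrite mevalXU /= nth_env.
have reprD q r : repr q -> repr r -> repr (q + r).
  move=> [t [rt tE]] [u [ru uE]]; exists (GRing.Add t u).
  by split=> [|x]; rewrite /= ?rt ?tE ?uE ?mevalD.
have reprM q r : repr q -> repr r -> repr (q * r).
  move=> [t [rt tE]] [u [ru uE]]; exists (GRing.Mul t u).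
  by split=> [|x]; rewrite /= ?rt ?tE ?uE ?mevalM.
rewrite -/(repr p) [p]mpolyE; apply: (big_ind repr) => //.
  by rewrite -mpolyC0.
move=> m _; rewrite -mul_mpolyC; apply: (reprM _ _ (reprC _)).
rewrite mpolyXE_id; apply: (big_ind repr) => //; first by rewrite -mpolyC1.
move=> i _; elim: (m i) => [|k IH]; first by rewrite expr0 -mpolyC1.
by rewrite exprS; apply: reprM.
Qed.

(** Each atomic formula compares two terms, that is, prescribes the sign of the
    polynomial that represents their difference; the connectives are the Boolean
    operations on sets. *)
Lemma semialgebraic_qf n (f : ord.formula R) :
  ord.qf_form f -> ord.rformula f ->
  semialgebraic [set x : 'rV[R]_n | ord.qf_eval (env x) f].
Proof.
have sub (t1 t2 : GRing.term R) : GRing.rterm t1 && GRing.rterm t2 ->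
    exists p : {mpoly R[n]}, forall x : 'rV[R]_n,
    p.@[fun i => x ord0 i] = GRing.eval (env x) t2 - GRing.eval (env x) t1.
  case/andP=> /(mpoly_of_term n)[p pE] /(mpoly_of_term n)[q qE].
  by exists (q - p) => x; rewrite mevalB pE qE.
elim: f => //=.
- by case=> _ _; [apply: eq_semialgebraic (semialgebraicT R n)
                | apply: eq_semialgebraic (semialgebraic0 R n)].
- move=> t1 t2 _ /sub[p pE].
  apply: eq_semialgebraic (semialgebraic_literal p Null) => x /=.
  by rewrite pE (rwP eqP) subr_eq0 eq_sym.
- move=> t1 t2 _ /sub[p pE].
  apply: eq_semialgebraic (semialgebraic_literal p Positive) => x /=.
  by rewrite pE subr_gt0.
- move=> t1 t2 _ /sub[p pE].
  apply: eq_semialgebraic (semialgebraic_literal p Nonnegative) => x /=.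
  by rewrite pE subr_ge0.
- move=> f IHf g IHg /andP[qf qg] /andP[rf rg].
  apply: eq_semialgebraic (semialgebraicI (IHf qf rf) (IHg qg rg)) => x /=.
  by split=> /andP.
- move=> f IHf g IHg /andP[qf qg] /andP[rf rg].
  apply: eq_semialgebraic (semialgebraicU (IHf qf rf) (IHg qg rg)) => x /=.
  by split=> /orP.
- move=> f IHf g IHg /andP[qf qg] /andP[rf rg].
  apply: eq_semialgebraic
    (semialgebraicU (semialgebraicC (IHf qf rf)) (IHg qg rg)) => x /=.
  by rewrite implybE; split=> [[/negP-> // | ->] | /orP[/negP|]];
     rewrite ?orbT //; [left | right].
- move=> f IHf qf rf.
  apply: eq_semialgebraic (semialgebraicC (IHf qf rf)) => x /=.
  by split=> /negP.
Qed.

Lemma formula_of_semialgebraic n (S : set 'rV[R]_n) : semialgebraic S ->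
  exists f : ord.formula R, ord.rformula f /\
    forall x, S x <-> ord.holds (env x) f.
Proof.
move=> /semialgebraicP[D SD].
suff [f [rf fE]] : exists f : ord.formula R, ord.rformula f /\
    forall x, dnf_holds D x <-> ord.holds (env x) f.
  by exists f; split=> // x; rewrite SD.
elim: D {S SD} => [|d D [g [rg gE]]]; first by exists (ord.Bool false).
suff [f [rf fE]] : exists f : ord.formula R, ord.rformula f /\
    forall x : 'rV[R]_n, all (literal_holds x) d <-> ord.holds (env x) f.
  exists (ord.Or f g); split=> [|x] /=; first by rewrite rf.
  by rewrite -fE -gE; split=> /orP.
elim: d {D g rg gE} => [|[p c] d [g [rg gE]]]; first by exists (ord.Bool true).
have [t [rt tE]] := term_of_mpoly p.
pose O := GRing.NatConst R 0.
exists (ord.And (match c with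
  | Positive => ord.Lt O t | Nonnegative => ord.Le O t | Null => ord.Equal t O
  end) g); split=> [|x] /=; first by case: c; rewrite /= rt.
rewrite -gE; suff: literal_holds x (p, c) <-> ord.holds (env x) match c with
  | Positive => ord.Lt O t | Nonnegative => ord.Le O t | Null => ord.Equal t O
  end by move=> <-; split=> /andP.
rewrite /literal_holds /= -tE; case: c => //=.
by split=> /eqP.
Qed.

(** Since [Exists i] overwrites entry [i] of the environment, quantifying over
    the indices that follow those of [e], in increasing order, appends values to
    [e] one after the other. *)
Lemma holds_exists_iota (f : ord.formula R) (m : nat) (e : seq R) :
  ord.holds e (foldr (@ord.Exists R) f (iota (size e) m)) <->
  exists2 s, size s = m & ord.holds (e ++ s) f.
Proof.
elim: m e => [|m IH] e /=.
  split=> [fe | [s /size0nil->]]; last by rewrite cats0.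
  by exists [::]; rewrite ?cats0.
have setE a : set_nth 0 e (size e) a = rcons e a.
  by elim: (e) => //= b e' ->.
split=> [[a] | [[//|a s] [sm] fs]].
  rewrite setE -(size_rcons e a) => /IH[s sm fs].
  by exists (a :: s); rewrite /= ?sm -?cat_rcons.
exists a; rewrite setE -(size_rcons e a); apply/IH.
by exists s; rewrite ?cat_rcons.
Qed.

(** In the environment of [row_mx x y] the coordinates of [y] are the variables
    [n, ..., n + m - 1]; quantifying them existentially and eliminating the
    quantifiers leaves a quantifier-free condition on [x]. *)
Theorem semialgebraic_projection n m (S : set 'rV[R]_(n + m)) :
  semialgebraic S ->
  semialgebraic [set x : 'rV[R]_n | exists y : 'rV[R]_m, S (row_mx x y)].
Proof.
move=> /formula_of_semialgebraic[f [rf fE]].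
pose g := foldr (@ord.Exists R) f (iota n m).
have rg : ord.rformula g by rewrite /g; elim: (iota n m).
have wf := qe_rcf.wf_QE_wproj (F := R).
have val := qe_rcf.valid_QE_wproj (F := R).
have /andP[qh rh] := ord.quantifier_elim_wf wf rg.
apply: eq_semialgebraic (semialgebraic_qf n qh rh) => x /=.
rewrite -(rwP (ord.quantifier_elim_rformP wf val _ rg)).
rewrite /g -[X in iota X m](size_env x) holds_exists_iota.
split=> [[s sm fs] | [y]].
  by exists (\row_(i < m) s`_i); rewrite fE env_row_mx envK.
by rewrite fE env_row_mx => fs; exists (env y) => //; rewrite size_env.
Qed.

End Projection.

(** * Characteristic polynomials of nonnegative matrices *)

(** The leading coefficient of a monic polynomial of degree [n] is already
    accounted for by ['X^n], and [i |-> n - i.+1] is a bijection from ['I_n] onto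
    the lower degrees, so comparing polynomials amounts to comparing the [n]
    lower coefficients. *)
Lemma monic_coefs_eqP (R : nzRingType) (n : nat) (p : {poly R}) (k : 'I_n -> R) :
  p \is monic -> size p = n.+1 ->
  p = 'X^n + \sum_(i < n) k i *: 'X^(n - i.+1) <->
  forall i : 'I_n, p`_(n - i.+1) = k i.
Proof.
move=> mp sp; set q := (X in 'X^n + X).
have qE (i : 'I_n) : q`_(n - i.+1) = k i.
  rewrite coef_sum (bigD1 i) //= coefZ coefXn eqxx mulr1 big1 ?addr0 // => j neji.
  rewrite coefZ coefXn; case: eqP => [eqij | _]; last by rewrite mulr0.
  case/eqP: neji; apply: val_inj; apply: succn_inj; apply/eqP.
  by rewrite -(eqn_sub2lE (ltn_ord j) (ltn_ord i)) eqij.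
have q0 j : (n <= j)%N -> q`_j = 0.
  move=> lenj; rewrite coef_sum big1 // => i _; rewrite coefZ coefXn.
  by case: eqP => [eqj | _]; rewrite ?mulr0 //; move: lenj;
     rewrite eqj leqNgt ltn_subrL (leq_ltn_trans _ (ltn_ord i)).
split=> [-> i | pk].
  by rewrite coefD coefXn qE ltn_eqF ?add0r // ltn_subrL (leq_ltn_trans _ (ltn_ord i)).
apply/polyP => j; rewrite coefD coefXn; case: (ltngtP j n) => [ltjn|ltnj|->].
- have ltr : (n - j.+1 < n)%N by rewrite ltn_subrL (leq_ltn_trans _ ltjn).
  have jE : j = (n - (Ordinal ltr).+1)%N by rewrite /= subnSK // subKn // ltnW.
  by rewrite add0r jE qE pk.
- by rewrite add0r nth_default ?sp // q0 // ltnW.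
- by rewrite q0 // addr0; move/monicP: mp; rewrite lead_coefE sp.
Qed.

Theorem lemma3p1 (R : realType) (n : nat) (hn : (1 <= n)%N) :
  semialgebraic (@realizable_coefficients R n).
Proof.
(* The matrix of indeterminates: the coordinates following the [n] ones of
   [k] are the entries of a matrix, in the order of [mxvec]. *)
pose G : 'M[{mpoly R[n + n * n]}]_n :=
  \matrix_(i, j) 'X_(rshift n (mxvec_index i j)).
(* Forming the characteristic polynomial commutes with the ring morphism that
   evaluates the indeterminates. *)
have evG (k : 'rV[R]_n) (A : 'M[R]_n) l :
    ((char_poly G)`_l).@[fun i => row_mx k (mxvec A) ord0 i] = (char_poly A)`_l.
  rewrite -coef_map map_char_poly; congr (char_poly _)`_l.
  by apply/matrixP => i j; rewrite !mxE /= mevalXU row_mxEr mxvecE.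
have Ssa : semialgebraic ([set v | forall j : 'I_(n * n),
      satisfies Nonnegative ('X_(rshift n j)).@[fun i => v ord0 i]] `&`
    [set v | forall i : 'I_n, satisfies Null
       ((char_poly G)`_(n - i.+1) - 'X_(lshift (n * n) i)).@[fun i => v ord0 i]]
    : set 'rV[R]_(n + n * n)).
  by apply: semialgebraicI; apply: semialgebraic_forall => i;
     exact: semialgebraic_literal.
apply: eq_semialgebraic (semialgebraic_projection Ssa) => k.
have cP (A : 'M[R]_n) := monic_coefs_eqP (fun i => k ord0 i)
  (char_poly_monic A) (size_char_poly A).
split=> [[a] | [A [A0 /cP kA]]].
  rewrite -(vec_mxK a) => -[/= a0 ka]; exists (vec_mx a); split=> [i j|].
    have := a0 (mxvec_index i j); rewrite mevalXU row_mxEr.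
    by rewrite mxvecE.
  apply/cP => i; have := ka i.
  by rewrite mevalB evG mevalXU row_mxEl => /eqP; rewrite subr_eq0 => /eqP.
exists (mxvec A); split=> /= [j | i].
  by rewrite mevalXU row_mxEr; case/mxvec_indexP: j => i j; rewrite mxvecE.
by rewrite mevalB evG mevalXU row_mxEl kA subrr.
Qed.
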